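(* Assume the Continuum Hypothesis. Then the space $\omega^*=\beta\omega\setminus\omega$ is non-reconstructible. Moreover, for every $P$-point $p$ of $\omega^*$, the space $\omega^*\setminus\{p\}$ is a reconstruction of $\omega^*$ that is not homeomorphic to $\omega^*$.
   Context: $\beta\omega$ is the Stone-Čech compactification of the countable discrete space $\omega$, and $\omega^*=\beta\omega\setminus\omega$ is its remainder. A $P$-point of a space is a point $p$ such that every countable intersection of neighbourhoods of $p$ contains a neighbourhood of $p$. A space $Y$ is a card of a space $X$ if $Y$ is homeomorphic to the subspace $X\setminus\{x\}$ for some $x\in X$. The deck $\mathcal{D}(X)$ of $X$ is the set of homeomorphism types of cards of $X$ (formally, a transversal for the non-homeomorphic cards). Thus $\mathcal{D}(X)=\mathcal{D}(Z)$ means that for every $x\in X$ there is $z\in Z$ with $X\setminus\{x\}\cong Z\setminus\{z\}$, and for every $z\in Z$ there is $x\in X$ with $Z\setminus\{z\}\cong X\setminus\{x\}$. In that case $X$ and $Z$ are called reconstructions of each other. A space $X$ is reconstructible if $\mathcal{D}(X)=\mathcal{D}(Z)$ implies $X\cong Z$ for every space $Z$; otherwise it is non-reconstructible. *)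

(* Defs.v *)
From HB Require Import structures.
From mathcomp Require Import all_boot.
From mathcomp Require Import all_classical.
From mathcomp Require Import topology.

Set Implicit Arguments.
Unset Strict Implicit.
Unset Printing Implicit Defensive.

Local Open Scope classical_set_scope.
Local Open Scope card_scope.

(* For [A : set X], the type [set_type A] (to which [A] coerces) carries the
   subspace topology, i.e. the initial topology of the inclusion; this is not
   the library's [subspace A], whose carrier is the whole of [X]. *)

Definition continuum_hypothesis : Prop :=
  forall A : set (set nat), countable A \/ A #= [set: set nat].

Definition homeomorphic (X Y : topologicalType) : Prop :=
  exists (f : X -> Y) (g : Y -> X),
    [/\ continuous f, continuous g, cancel f g & cancel g f].

Definition P_point (X : topologicalType) (p : X) : Prop :=
  forall U : nat -> set X, (forall n, nbhs p (U n)) ->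
    exists2 V, nbhs p V & V `<=` \bigcap_n U n.

Definition remove_point (X : topologicalType) (x : X) : topologicalType :=
  set_type (~` [set x]).

Definition same_deck (X Z : topologicalType) : Prop :=
  (forall x : X, exists z : Z, homeomorphic (remove_point x) (remove_point z)) /\
  (forall z : Z, exists x : X, homeomorphic (remove_point z) (remove_point x)).

Definition reconstruction (Z X : topologicalType) : Prop := same_deck X Z.

Definition reconstructible (X : topologicalType) : Prop :=
  forall Z : topologicalType, same_deck X Z -> homeomorphic X Z.

Record is_stone_cech (X B : topologicalType) (e : X -> B) : Prop := {
  stone_cech_compact : compact [set: B];
  stone_cech_hausdorff : hausdorff_space B;
  stone_cech_dense : dense (range e);
  stone_cech_inj : injective e;
  stone_cech_initial : forall U : set X,
    open U <-> exists2 V : set B, open V & e @^-1` V = U;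
  stone_cech_extension : forall (K : topologicalType) (f : X -> K),
    compact [set: K] -> hausdorff_space K -> continuous f ->
    exists2 g : B -> K, continuous g & forall x, g (e x) = f x
}.

(* The space of ultrafilters on [nat], with the basic open sets
   [set p | p A] for A a set of natural numbers; [beta_omegaP] below shows
   that it is the Stone-Cech compactification of the discrete space [nat]. *)
Record beta_omega := BetaOmega {
  ultra_of :> set nat -> Prop;
  ultra_ofP : UltraFilter ultra_of
}.
#[global] Existing Instance ultra_ofP.

Lemma beta_omega_inj : injective ultra_of.
Proof.
by move=> [F FU] [G GU] /= FG; subst G; congr BetaOmega; exact: Prop_irrelevance.
Qed.

HB.instance Definition _ := gen_eqMixin beta_omega.
HB.instance Definition _ := gen_choiceMixin beta_omega.

Definition beta_basic (A : set nat) : set beta_omega := [set p : beta_omega | p A].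

Lemma beta_basic_cover : \bigcup_(A in setT) beta_basic A = setT.
Proof.
by rewrite -subTset => p _; exists setT => //; exact: filterT.
Qed.

Lemma beta_basic_join (A B : set nat) (p : beta_omega) : setT A -> setT B ->
  beta_basic A p -> beta_basic B p ->
  exists C, [/\ setT C, beta_basic C p &
                beta_basic C `<=` beta_basic A `&` beta_basic B].
Proof.
move=> _ _ pA pB; exists (A `&` B); split=> //; first exact: filterI.
by move=> q qAB; split; apply: filterS qAB => n [].
Qed.

HB.instance Definition _ :=
  isBaseTopological.Build beta_omega beta_basic_cover beta_basic_join.

Definition principal (n : nat) : beta_omega :=
  BetaOmega (principal_filter_ultra n).

Definition omega_star : topologicalType := set_type (~` range principal).

Lemma open_beta_basic (A : set nat) : open (beta_basic A).
Proof. by exists [set A] => //; rewrite bigcup_set1. Qed.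

Lemma open_beta_basicP (U : set beta_omega) (p : beta_omega) :
  open U -> U p -> exists2 A, p A & beta_basic A `<=` U.
Proof.
move=> [D _ <-] [A DA pA]; exists A => // q qA; by exists A.
Qed.

Lemma ultra_of_dichotomy (T : Type) (F : set_system T) :
  ProperFilter F -> (forall A, F A \/ F (~` A)) -> UltraFilter F.
Proof.
move=> FF FA; split=> // G GF FG; rewrite eqEsubset; split=> // A GA.
have [//|/FG GnA] := FA A.
by have /filter_ex [? []] : G (A `&` ~` A) by exact: filterI.
Qed.

Lemma ultra_fmap (T U : Type) (f : T -> U) (F : set_system T) :
  UltraFilter F -> UltraFilter (f @ F).
Proof.
move=> FU; apply: ultra_of_dichotomy => A.
exact: (in_ultra_setVsetC (f @^-1` A)).
Qed.

Lemma beta_omega_compact : compact [set: beta_omega].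
Proof.
rewrite compact_ultra => F FU _.
have pU : UltraFilter [set A | F (beta_basic A)].
  apply: ultra_of_dichotomy.
    split.
      move=> F0; have /filter_ex [q] : F (beta_basic set0) by exact: F0.
      by apply: filter_not_empty.
    split=> /=.
    - by apply: (@filterS _ F _ setT) => [q _|]; exact: filterT.
    - by move=> A B FA FB; apply: (@filterS _ F _ (beta_basic A `&` beta_basic B));
        [by move=> q [qA qB]; exact: filterI | exact: filterI].
    - by move=> A B AB; apply: (@filterS _ F) => q; exact: filterS.
  move=> A /=; have [FA|FA] := in_ultra_setVsetC (beta_basic A) FU; first by left.
  right; apply: filterS FA => q /= nqA.
  by have [] := in_ultra_setVsetC A (ultra_ofP q).
exists (BetaOmega pU); split=> // V; rewrite nbhsE => -[W [oW Wp] WV].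
have [A FA AW] := open_beta_basicP oW Wp.
exact: (@filterS _ F _ _ _ (subset_trans AW WV) FA).
Qed.

Lemma beta_omega_hausdorff : hausdorff_space beta_omega.
Proof.
move=> p q pq; apply: beta_omega_inj.
suff pS : ultra_of p `<=` ultra_of q by apply/esym/max_filter.
move=> A pA; have [//|qA] := in_ultra_setVsetC A (ultra_ofP q).
have [||r [rA rnA]] := pq (beta_basic A) (beta_basic (~` A)).
- by apply: open_nbhs_nbhs; split=> //; exact: open_beta_basic.
- by apply: open_nbhs_nbhs; split=> //; exact: open_beta_basic.
by have /filter_ex [? []] : ultra_of r (A `&` ~` A) by exact: filterI.
Qed.

Lemma beta_omegaP : is_stone_cech principal.
Proof.
split.
- exact: beta_omega_compact.
- exact: beta_omega_hausdorff.
- move=> O [p Op] oO; have [A pA AO] := open_beta_basicP oO Op.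
  have [n An] := filter_ex pA.
  by exists (principal n); split; [apply/AO/principal_filterP | exists n].
- move=> m n /(congr1 ultra_of) /= mn.
  have : principal_filter m [set m] by apply/principal_filterP.
  by rewrite mn => /principal_filterP.
- move=> U; split=> [_|_]; last exact: discrete_open.
  exists (beta_basic U); first exact: open_beta_basic.
  by rewrite predeqE => n; split=> [/principal_filterP|?]; last apply/principal_filterP.
- move=> K f cK hK _.
  have lim_ex (p : beta_omega) : exists k : K, nbhs k `<=` fmap f (ultra_of p).
    have := cK; rewrite compact_ultra => /(_ _ (ultra_fmap f (ultra_ofP p))).
    by move=> /(_ filterT)[k [_ kP]]; exists k => U; exact: kP.
  have [g gP] := choice lim_ex.
  exists g.
    move=> p U; have /(_ _ _)/[apply] := compact_regular hK cK (filterT : nbhs (g p) setT).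
    move=> [V gpV VU]; have pV := gP p _ gpV.
    have : nbhs p (beta_basic (f @^-1` V)).
      by apply: open_nbhs_nbhs; split=> //; exact: open_beta_basic.
    apply: filterS => q qV; apply: VU => W gqW.
    have /filter_ex [n [? ?]] : ultra_of q (f @^-1` V `&` f @^-1` W).
      by apply: filterI => //; exact: gP.
    by exists (f n).
  move=> n; have FF := @ultra_proper _ _ (ultra_fmap f (ultra_ofP (principal n))).
  apply: (@cvg_unique _ hK _ FF) => U => [|fnU]; first exact: gP.
  by apply/principal_filterP; exact: nbhs_singleton fnU.
Qed.

(* Main.v *)
Require Import Defs.
From mathcomp Require Import all_boot all_classical.
From mathcomp Require Import topology.
From Stdlib Require Inverse_Image.

(* An ideal J of sets of naturals determines the open set of those free
   ultrafilters that meet J.  Say that J is a P-ideal if countable subsets have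
   almost-inclusion bounds, and nonprincipal if it has no almost-greatest member.

   Under CH any two nonprincipal P-ideals J, J' give homeomorphic open sets: a
   recursion of length omega_1 builds an almost-increasing chain of partial
   injections of the naturals whose domains are cofinal in J and whose ranges are
   cofinal in J'.  Limit steps of cofinality omega are passed by discarding
   finitely many pairs from each injection of a countable cofinal subchain.

   Every point z splits: omega^* minus z is the disjoint union of two open sets,
   one of which comes from a nonprincipal P-ideal J.  Given another point p, the
   splitting can be arranged so that p lies in that part.  If p is a P-point then
   the members of J outside p again form a nonprincipal P-ideal, so deleting p from
   this part does not change its homeomorphism type; hence omega^* minus z is
   homeomorphic to omega^* minus {z, p}.  Taking z = x for x <> p, and for x = p a
   second P-point, matches the decks. *)

Set Implicit Arguments.
Unset Strict Implicit.
Unset Printing Implicit Defensive.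

Local Open Scope classical_set_scope.
Local Open Scope card_scope.

(** * Recursion of length omega_1 *)

Lemma exists_well_order (T : eqType) : exists lt : T -> T -> Prop,
  well_founded lt /\ forall x y, [\/ lt x y, x = y | lt y x].
Proof.
have [R Rwo] := wochoice.well_ordering_principle T.
pose lt x y := R x y /\ x <> y; exists lt; split.
  move=> x; apply: contrapT => nAx.
  have [|z [[/asboolP nAz zmin] _]] := Rwo (fun y => `[< ~ Acc lt y >]).
    by exists x; apply/asboolP.
  apply: nAz; constructor => y [Ryz yz]; apply: contrapT => nAy; apply: yz.
  have yA : y \in (fun y => `[< ~ Acc lt y >]) by apply/asboolP.
  (* Antisymmetry of [R] at [y] and [z] follows from uniqueness of the least element of this
     pair. *)
  have [|w [_ wU]] := Rwo (mem [:: y; z]); first by exists y; rewrite inE eqxx.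
  have Rzy := zmin _ yA.
  have R_refl u : R u u.
    have [|v [[+ vm] _]] := Rwo (mem [:: u]); first by exists u; rewrite inE.
    by rewrite inE => /eqP vu; rewrite -{1}vu; apply: vm; rewrite inE.
  rewrite -(wU y) ?(wU z)//; split; rewrite ?inE ?eqxx ?orbT // => u;
    by rewrite !inE => /orP[] /eqP ->.
move=> x y; have [->|xy] := pselect (x = y); first exact: Or32.
have [|v [[+ vm] _]] := Rwo (mem [:: x; y]); first by exists x; rewrite inE eqxx.
have := vm x; have := vm y; rewrite !inE !eqxx orbT => /(_ isT) vy /(_ isT) vx.
move=> /orP[] /eqP vE; subst v; first exact: Or31.
by apply: Or33; split=> // yx; exact: xy.
Qed.

(** If a well-order of the sets of naturals has an uncountable initial segment, CH puts the least
    such segment in bijection with all of them; the order is pulled back along that bijection. *)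
Lemma CH_well_order : continuum_hypothesis ->
  exists lt : set nat -> set nat -> Prop, [/\ well_founded lt,
    forall A B, [\/ lt A B, A = B | lt B A] &
    forall A, countable [set B | lt B A]].
Proof.
move=> CH; have [lt [ltwf ltT]] := exists_well_order (set nat).
have [allc|/existsNP[A]] := pselect (forall A, countable [set B | lt B A]).
  by exists lt; split.
elim/(well_founded_ind ltwf): A => A IH nA.
have [minA|/contrapT[C [CA nC]]] :=
  pselect (~ exists C, lt C A /\ ~ countable [set B | lt B C]).
  2: exact: IH C CA nC.
have [//|] := CH [set B | lt B A].
rewrite card_eq_sym => /pcard_eqP/bijPex[f [fA finj _]].
exists (fun B C => lt (f B) (f C)); split.
- exact: Inverse_Image.wf_inverse_image.
- move=> B C; have [?|fBC|?] := ltT (f B) (f C); [exact: Or31| |exact: Or33].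
  by apply: Or32; apply: finj; rewrite ?inE.
- move=> B; have cB : countable [set C | lt C (f B)].
    by apply: contrapT => nB; apply: minA; exists (f B); split=> //; exact: fA.
  apply: sub_countable cB; apply/pcard_leP/injfunPex; exists f => //.
  by move=> C D _ _; apply: finj; rewrite ?inE.
Qed.

Lemma uncountable_powerset_nat : ~ countable [set: set nat].
Proof.
case/countable_injP => f finj.
pose D := [set n | exists2 A, f A = n & ~ A n].
have DfD : D (f D) <-> ~ D (f D).
  split=> [[A fA nA]|nD]; last by exists D.
  have AD : A = D by apply: finj; rewrite ?inE.
  by rewrite -{1}AD.
tauto.
Qed.

Lemma countable_enum (T : Type) (A : set T) : countable A -> A !=set0 ->
  exists s : nat -> T, range s = A.
Proof.
move=> cA A0.
have := cA; move/pfcard_geP => [A0'|[f]]; first by move: A0; rewrite A0' => -[].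
by exists f; rewrite image_eq.
Qed.

(** Enumerating the predecessors of a stage ignores their order, so the terms are only pairwise
    comparable. *)
Definition comparable_seq (T : Type) (R : T -> T -> Prop) (x : nat -> T) :=
  forall m n, R (x m) (x n) \/ R (x n) (x m).

(** Stage [A] picks a condition in [D A] above all earlier ones, which are countably many and hence
    bounded. No countable set of stages is cofinal, which gives the last clause. *)
Lemma CH_generic_family (T : Type) (V : set T) (R : T -> T -> Prop)
    (D : set nat -> set T) :
  continuum_hypothesis ->
  (forall x, V x -> R x x) -> (forall x y z, R x y -> R y z -> R x z) ->
  V !=set0 ->
  (forall x : nat -> T, (forall n, V (x n)) -> comparable_seq R x ->
    exists2 y, V y & forall n, R (x n) y) ->
  (forall A x, V x -> exists2 y, V y & R x y /\ D A y) ->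
  exists x : set nat -> T, [/\ forall A, V (x A), forall A, D A (x A) &
    forall s : nat -> set nat, exists A, forall n, R (x (s n)) (x A)].
Proof.
elim/Pchoice: T => T in V R D *; move=> CH Rxx Rtr [t0 Vt0] Rclosed Rdense.
have [lt [ltwf ltT ltC]] := CH_well_order CH.
pose good A (rec : forall B, lt B A -> T) t :=
  [/\ V t, D A t & forall B (BA : lt B A), R (rec B BA) t].
(* The default [t0] of [xget] is harmless: [xP] shows that a good condition exists at each stage. *)
pose F A rec : T := xget t0 (good A rec).
pose x := Fix ltwf (fun _ => T) F.
have xE A : x A = F A (fun B _ => x B).
  rewrite /x Fix_eq // => B f g fg; congr (F _ _).
  by apply: functional_extensionality_dep => C; apply/funext.
have xP A : good A (fun B _ => x B) (x A).
  elim/(well_founded_ind ltwf): A => A IH.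
  suff [t tP] : exists t, good A (fun B _ => x B) t.
    by rewrite xE; apply: (xgetPex t0); exists t.
  have [y Vy xy] : exists2 y, V y & forall B, lt B A -> R (x B) y.
    have [nA|A0] := eqVneq [set B | lt B A] set0.
      by exists t0 => // B BA; have : [set B | lt B A] B by []; rewrite nA.
    have [s sA] := countable_enum (ltC A) (iffLR (set0P _) A0).
    have ltsA n : lt (s n) A by have : range s (s n) by []; rewrite sA.
    have [||y Vy sy] := Rclosed (x \o s).
    - by move=> n; have [] := IH _ (ltsA n).
    - move=> m n /=; have [mn|->|nm] := ltT (s m) (s n).
      + by left; have [_ _] := IH _ (ltsA n); apply.
      + by left; apply: Rxx; have [] := IH _ (ltsA n).
      + by right; have [_ _] := IH _ (ltsA m); apply.
    exists y => // B BA; have : range s B by rewrite sA.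
    by case=> n _ <-; exact: sy.
  have [t Vt [yt Dt]] := Rdense A y Vy.
  by exists t; split=> // B BA; exact: Rtr (xy B BA) yt.
exists x; split=> [A|A|s]; [by have [] := xP A|by have [] := xP A|].
(* Otherwise the countable initial segments up to the [s n] would cover all sets of naturals. *)
have [A As] : exists A, forall n, lt (s n) A.
  apply: contrapT => /forallNP nA; apply: uncountable_powerset_nat.
  apply: (@sub_countable _ _ _ (\bigcup_n ([set B | lt B (s n)] `|` [set s n]))).
    apply: subset_card_le => A _.
    have /existsNP[n nsA] := nA A; exists n => //.
    by have [//|->|] := ltT (s n) A; [right|left].
  apply: bigcup_countable => // n _.
  rewrite -bigcup2E; apply: bigcup_countable => // -[|[|k]] _ //=; exact: ltC.
by exists A => n; have [_ _] := xP A; apply.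
Qed.

(** * Almost inclusion and partial injections *)

Definition almost_sub (T : Type) (A B : set T) := finite_set (A `\` B).

Local Notation "A `<=* B" := (almost_sub A B) (at level 70).

Section almost_inclusion.
Context {T : Type}.
Implicit Types A B C : set T.

Lemma subset_almost_sub A B : A `<=` B -> A `<=* B.
Proof. by rewrite -setD_eq0 /almost_sub => ->. Qed.

Lemma almost_sub_refl A : A `<=* A.
Proof. exact: subset_almost_sub. Qed.

Lemma almost_sub_trans A B C : A `<=* B -> B `<=* C -> A `<=* C.
Proof.
move=> AB BC; apply: (@sub_finite_set _ _ ((A `\` B) `|` (B `\` C))).
  by move=> x [Ax nCx]; have [Bx|nBx] := pselect (B x); [right|left].
by rewrite finite_setU.
Qed.

Lemma sub_almost_sub A B C : A `<=` B -> B `<=* C -> A `<=* C.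
Proof. by move=> /subset_almost_sub; exact: almost_sub_trans. Qed.

Lemma almost_subU A B C : A `<=* C -> B `<=* C -> A `|` B `<=* C.
Proof. by move=> AC BC; rewrite /almost_sub setDUl finite_setU. Qed.

Lemma almost_subI_finite A B C : A `<=* B -> finite_set (B `&` C) ->
  finite_set (A `&` C).
Proof.
move=> AB BC; apply: (@sub_finite_set _ _ ((A `\` B) `|` (B `&` C))).
  by move=> x [Ax Cx]; have [Bx|nBx] := pselect (B x); [right|left].
by rewrite finite_setU.
Qed.

Lemma finite_subset1 A : (forall x y, A x -> A y -> x = y) -> finite_set A.
Proof.
move=> A1; have [[x Ax]|/set0P/negP/negPn/eqP->//] := pselect (A !=set0).
by apply: (@sub_finite_set _ _ [set x]) => // y /A1; apply.
Qed.

Lemma infinite_range (f : nat -> T) : injective f -> infinite_set (range f).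
Proof.
move=> finj fin; apply: infinite_nat.
apply: (@sub_finite_set _ _ (f @^-1` range f)); first by move=> n _; exists n.
by apply: finite_preimage fin => m n _ _; exact: finj.
Qed.

(** Along an injective sequence in [A], the even terms form [B] and the odd terms remain outside
    it. *)
Lemma infinite_split A : infinite_set A ->
  exists B, [/\ B `<=` A, infinite_set B & infinite_set (A `\` B)].
Proof.
move=> /infiniteP/card_leP[f].
pose g n := sval (f (SigSub (mem_setT n))).
have ginj : injective g.
  move=> m n /val_inj mn; suff [] : @SigSub _ _ _ m (mem_setT m) =
    SigSub (mem_setT n) :> [set: nat] by [].
  by apply: (@inj _ _ setT f); rewrite ?inE.
have gA n : A (g n) by apply: set_mem; exact: (svalP (f _)).
exists (range (g \o double)); split.
- by move=> _ [n _ <-]; exact: gA.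
- by apply: infinite_range; apply: inj_comp ginj double_inj.
apply: (@sub_infinite_set _ (range (g \o S \o double))).
  move=> _ [n _ <-]; split; first exact: gA.
  by move=> [m _ /ginj/(congr1 odd)]; rewrite /= !odd_double.
by apply: infinite_range; apply: inj_comp double_inj; apply: inj_comp ginj succn_inj.
Qed.

End almost_inclusion.

(** [P_idealS] covers subsets as well as finite changes; finite unions come from [P_ideal_bound], as
    in [P_idealU]. *)
Record P_ideal (J : set (set nat)) : Prop := {
  P_ideal0 : J set0;
  P_idealS : forall a b, J b -> a `<=* b -> J a;
  P_ideal_bound : forall a : nat -> set nat, (forall n, J (a n)) ->
    exists2 b, J b & forall n, a n `<=* b
}.

Definition nonprincipal (J : set (set nat)) :=
  forall c, J c -> exists2 a, J a & infinite_set (a `\` c).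

Lemma P_idealU J a b : P_ideal J -> J a -> J b -> J (a `|` b).
Proof.
move=> PJ Ja Jb.
have [|c Jc abc] := P_ideal_bound PJ (a := fun n => if n is 0 then a else b).
  by case.
apply: P_idealS Jc _ => //; apply: almost_subU; [exact: (abc 0)|exact: (abc 1)].
Qed.

Section partial_injections.
Implicit Types (G H : set (nat * nat)) (A B : set nat).

(** One equivalence expresses functionality and injectivity at once. *)
Definition compatible (e e' : nat * nat) := e.1 = e'.1 <-> e.2 = e'.2.

Definition partial_injection G := forall e e', G e -> G e' -> compatible e e'.

Definition rel_preimage G B := [set m | exists2 n, G (m, n) & B n].

Definition rel_dom G := rel_preimage G setT.

Definition converse G := [set e | G (e.2, e.1)].

Lemma converseK G : converse (converse G) = G.
Proof. by apply/seteqP; split=> -[m n]. Qed.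

Lemma converse_partial_injection G :
  partial_injection G -> partial_injection (converse G).
Proof. by move=> Gp [m n] [m' n'] /= Gmn Gmn'; have [] := Gp _ _ Gmn Gmn'. Qed.

Lemma converse_almost_sub G H : G `<=* H -> converse G `<=* converse H.
Proof.
move=> /(finite_image (fun e => (e.2, e.1))).
by apply: sub_finite_set => -[m n] [Gmn nHmn]; exists (n, m).
Qed.

Lemma rel_preimage_almost_sub G H B : G `<=* H ->
  rel_preimage G B `<=* rel_preimage H B.
Proof.
move=> /(finite_image fst); apply: sub_finite_set => m [[n Gmn Bn] nHm].
by exists (m, n) => //; split=> // Hmn; apply: nHm; exists n.
Qed.

Lemma partial_injection_restrict G A : partial_injection G ->
  rel_dom G `<=* A -> finite_set [set e | G e /\ ~ A e.1].
Proof.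
move=> Gp GA.
apply: (@sub_finite_set _ _ (\bigcup_(m in rel_dom G `\` A) [set e | G e /\ e.1 = m])).
  by move=> [m n] [Gmn Am]; exists m => //; split=> //; exists n.
apply: bigcup_finite => // m _; apply: finite_subset1 => -[m1 n1] [m2 n2] /=.
by move=> [G1 e1] [G2 e2]; have [/= /(_ _)->//] := Gp _ _ G1 G2; rewrite e1 e2.
Qed.

(** If [G] is almost included in [H], a clashing pair of [G] lies outside [H]. In the other case its
    partner is one of finitely many pairs of [H] outside [G], and shares a coordinate with at most
    two pairs of [G]. *)
Lemma finite_incompatible G H : partial_injection G ->
  partial_injection H -> G `<=* H \/ H `<=* G ->
  finite_set [set e | G e /\ exists2 e', H e' & ~ compatible e e'].
Proof.
move=> Gp Hp [GH|HG].
  apply: sub_finite_set GH => e [Ge [e' He' ee']]; split=> // He.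
  by apply: ee'; exact: Hp.
apply: (@sub_finite_set _ _ (\bigcup_(e' in H `\` G)
  ([set e | G e /\ e.1 = e'.1] `|` [set e | G e /\ e.2 = e'.2]))).
  move=> e [Ge [e' He' ee']]; exists e'.
    by split=> // Ge'; apply: ee'; exact: Gp.
  have [e1|e1] := pselect (e.1 = e'.1); first by left.
  by right; split=> //; apply: contrapT => e2; apply: ee'; split.
apply: bigcup_finite => // -[m' n'] _; rewrite finite_setU.
split; apply: finite_subset1 => -[m1 n1] [m2 n2] /= [G1 <-] [G2 e].
  by have [/= /(_ _)->] := Gp _ _ G1 G2; rewrite ?e.
by have [/= _ /(_ _)->] := Gp _ _ G1 G2; rewrite ?e.
Qed.

Lemma partial_injection_bound (G : nat -> set (nat * nat)) (A B : set nat) :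
  (forall n, partial_injection (G n)) -> comparable_seq (@almost_sub _) G ->
  (forall n, rel_dom (G n) `<=* A) ->
  (forall n, rel_dom (converse (G n)) `<=* B) ->
  exists2 H, partial_injection H & [/\ forall n, G n `<=* H,
    rel_dom H `<=` A & rel_dom (converse H) `<=` B].
Proof.
move=> Gp Gcmp GA GB.
(* Keep from [G n] the pairs compatible with all of [G 0], ..., [G n.-1]: as any two
   of these injections are almost included one in the other, only finitely many
   pairs are lost. *)
exists [set e | exists n, [/\ G n e, A e.1, B e.2 &
  forall m, (m < n)%N -> forall e', G m e' -> compatible e e']].
  move=> e e' [n [Ge _ _ en]] [n' [Ge' _ _ e'n']].
  have [nn'|nn'|nn'] := ltngtP n n'.
  - by have [? ?] := e'n' _ nn' _ Ge; split=> /esym ?; apply/esym; auto.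
  - exact: en nn' _ Ge'.
  - by subst n'; exact: (Gp n).
split; last 2 first.
- by move=> m [n' [n []]].
- by move=> n' [m [n []]].
(* A discarded pair of [G n] leaves [A], leaves [B], or clashes with one of finitely many earlier
   injections. *)
move=> n; apply: (@sub_finite_set _ _ (
  [set e | G n e /\ ~ A e.1] `|` [set e | G n e /\ ~ B e.2] `|`
  \bigcup_(m in `I_n) [set e | G n e /\ exists2 e', G m e' & ~ compatible e e'])).
  move=> e [Ge ne]; apply: contrapT => /not_orP[/not_orP[nA nB] nI].
  apply: ne; exists n; split=> //.
  - by apply: contrapT => ?; apply: nA.
  - by apply: contrapT => ?; apply: nB.
  - move=> m mn e' Ge'; apply: contrapT => ?; apply: nI; exists m => //.
    by split=> //; exists e'.
rewrite !finite_setU; split; first split.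
- exact: partial_injection_restrict.
- have := partial_injection_restrict (converse_partial_injection (Gp n)) (GB n).
  move=> /(finite_image (fun e => (e.2, e.1))); apply: sub_finite_set.
  by move=> [k l] [Gkl nB]; exists (l, k).
apply: bigcup_finite; first exact: finite_II.
by move=> m _; exact: finite_incompatible.
Qed.

(** Add to [G] a bijection between sets [E] in [J] and [F] in [J'] that are disjoint from its domain
    and range and cover what is missing of [A] and [B]. Nonprincipality allows both to be infinite,
    hence equinumerous. *)
Lemma partial_injection_extend (J J' : set (set nat)) G A B :
  P_ideal J -> nonprincipal J -> P_ideal J' -> nonprincipal J' ->
  partial_injection G -> J (rel_dom G) -> J' (rel_dom (converse G)) ->
  J A -> J' B ->
  exists2 H, [/\ partial_injection H, J (rel_dom H) & J' (rel_dom (converse H))] &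
    [/\ G `<=` H, A `<=` rel_dom H & B `<=` rel_dom (converse H)].
Proof.
have ext K C D : P_ideal K -> nonprincipal K -> K C -> K D ->
    exists2 E, K E & [/\ infinite_set E, C `<=` D `|` E & D `&` E = set0].
  move=> PK nK KC KD; have [E KE iE] := nK D KD.
  exists ((C `|` E) `\` D).
    by apply: P_idealS (P_idealU PK KC KE) _ => //; apply: subset_almost_sub => ? [].
  split; last by apply/seteqP; split=> // n [? []].
    by apply: sub_infinite_set iE => n [? ?]; split=> //; right.
  by move=> n Cn; have [?|?] := pselect (D n); [left|right; split=> //; left].
move=> PJ nJ PJ' nJ' Gp JG JG' JA JB.
have [E JE [iE AE GE]] := ext _ _ _ PJ nJ JA JG.
have [F JF [iF BF GF]] := ext _ _ _ PJ' nJ' JB JG'.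
have /card_set_bijP[f [fE finj fF]] : E #= F.
  apply: card_eq_trans (eq_card_nat (countableP _) iE) _.
  by rewrite card_eq_sym; exact: eq_card_nat.
pose H := G `|` [set e | E e.1 /\ f e.1 = e.2].
have domH : rel_dom H `<=` rel_dom G `|` E.
  by move=> m [n [Gmn|[Em _]] _]; [left; exists n|right].
have ranH : rel_dom (converse H) `<=` rel_dom (converse G) `|` F.
  by move=> n [m [Gmn|[/= Em <-]] _]; [left; exists m|right; exact: fE].
have GnE m n : G (m, n) -> ~ E m.
  by move=> Gmn Em; have : (rel_dom G `&` E) m; [split=> //; exists n|rewrite GE].
have GnF m n : G (m, n) -> ~ F n.
  move=> Gmn Fn; have : (rel_dom (converse G) `&` F) n; last by rewrite GF.
  by split=> //; exists m.
exists H; split.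
- move=> [m n] [m' n'] [Gmn|[/= Em mn]]; move=> [Gmn'|[/= Em' mn']].
  + exact: Gp.
  + split=> /= e; first by move: Em'; rewrite -e => /(GnE _ _ Gmn).
    by have := fE _ Em'; rewrite mn' -e => /(GnF _ _ Gmn).
  + split=> /= e; first by move: Em; rewrite e => /(GnE _ _ Gmn').
    by have := fE _ Em; rewrite mn e => /(GnF _ _ Gmn').
  + split=> /= e; first by rewrite -mn -mn' e.
    by apply: finj; rewrite ?inE// mn mn'.
- exact: P_idealS (P_idealU PJ JG JE) (subset_almost_sub domH).
- exact: P_idealS (P_idealU PJ' JG' JF) (subset_almost_sub ranH).
- by left.
- move=> m /AE[[n Gmn _]|Em]; first by exists n => //; left.
  by exists (f m) => //; right.
- move=> n /BF[[m Gmn _]|Fn]; first by exists m => //; left.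
  by have [m Em <-] := fF _ Fn; exists m => //; right.
Qed.

End partial_injections.

(** * Matching systems between two P-ideals *)

Record matching_system (J J' : set (set nat)) (G : set nat -> set (nat * nat)) :
    Prop := {
  matching_inj : forall i, partial_injection (G i);
  matching_dom : forall i, J (rel_dom (G i));
  matching_ran : forall i, J' (rel_dom (converse (G i)));
  matching_dir : forall i j, exists2 k, G i `<=* G k & G j `<=* G k;
  matching_dom_cofinal : forall A, J A -> exists i, A `<=* rel_dom (G i);
  matching_ran_cofinal : forall A, J' A ->
    exists i, A `<=* rel_dom (converse (G i))
}.

Lemma converse_matching_system J J' G : matching_system J J' G ->
  matching_system J' J (fun i => converse (G i)).
Proof.
case=> Ginj Gdom Gran Gdir Gdomc Granc; split=> [i|//|i|i j|//|A /Gdomc[i Ai]].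
- exact: converse_partial_injection.
- by rewrite converseK.
- by have [k ik jk] := Gdir i j; exists k; exact: converse_almost_sub.
- by exists i; rewrite converseK.
Qed.

Lemma CH_matching_system (J J' : set (set nat)) : continuum_hypothesis ->
  P_ideal J -> nonprincipal J -> P_ideal J' -> nonprincipal J' ->
  exists G, matching_system J J' G.
Proof.
move=> CH PJ nJ PJ' nJ'.
pose V := [set G | [/\ partial_injection G, J (rel_dom G) &
                       J' (rel_dom (converse G))]].
have V0 : V !=set0.
  exists set0; split=> //; apply: P_idealS (P_ideal0 _) _ => //;
    by apply: subset_almost_sub => ? [].
(* Stage [A] settles both cofinality requirements for [A] itself. *)
pose D A := [set G | (J A -> A `<=* rel_dom G) /\
                     (J' A -> A `<=* rel_dom (converse G))].
have [||||G [GV GD Gdir]] := @CH_generic_family _ V (@almost_sub _) D CH _ _ V0.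
- by move=> ? _; exact: almost_sub_refl.
- exact: almost_sub_trans.
- move=> G GV Gcmp.
  have [|A JA GA] := P_ideal_bound PJ (a := rel_dom \o G).
    by move=> n; case: (GV n).
  have [|B JB GB] := P_ideal_bound PJ' (a := rel_dom \o converse \o G).
    by move=> n; case: (GV n).
  have [n|H Hp [GH HA HB]] := partial_injection_bound _ Gcmp GA GB.
    by case: (GV n).
  exists H => //; split=> //.
    exact: P_idealS JA (subset_almost_sub HA).
  exact: P_idealS JB (subset_almost_sub HB).
- move=> A G [Gp JG JG'].
  (* In an ideal that does not contain [A], the empty set takes its place. *)
  have J0 (K : set (set nat)) : P_ideal K -> exists2 B, K B & K A -> A = B.
    move=> PK; have [KA|nKA] := pselect (K A); first by exists A.
    by exists set0 => //; exact: P_ideal0.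
  have [B JB AB] := J0 _ PJ; have [C JC AC] := J0 _ PJ'.
  have [H VH [GH BH CH']] :=
    partial_injection_extend PJ nJ PJ' nJ' Gp JG JG' JB JC.
  exists H => //; split; first exact: subset_almost_sub.
  by split=> [/AB|/AC] ->; exact: subset_almost_sub.
exists G; split=> [i|i|i|i j|A JA|A JA].
- by case: (GV i).
- by case: (GV i).
- by case: (GV i).
- have [k ijk] := Gdir (fun n => if n is 0 then i else j).
  by exists k; [exact: (ijk 0)|exact: (ijk 1)].
- by exists A; have [+ _] := GD A; apply.
- by exists A; have [_ +] := GD A; apply.
Qed.

(** * Transport of ultrafilters *)

Lemma ultra_notC (q : beta_omega) A : q (~` A) <-> ~ q A.
Proof.
split=> [qnA qA|nqA]; last by have [] := in_ultra_setVsetC A (ultra_ofP q).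
by have /filter_ex[n []] : q (A `&` ~` A) by exact: filterI.
Qed.

Lemma ultra_setU (q : beta_omega) A B : q (A `|` B) -> q A \/ q B.
Proof.
move=> qAB; have [qA|qnA] := in_ultra_setVsetC A (ultra_ofP q); first by left.
by right; apply: filterS (filterI qAB qnA) => n [[]].
Qed.

Lemma ultra_sub_eq (p q : beta_omega) : (forall A, p A -> q A) -> p = q.
Proof. by move=> pq; apply/beta_omega_inj/esym/max_filter. Qed.

Definition free (q : beta_omega) := forall A, finite_set A -> ~ q A.

Lemma free_infinite q A : free q -> q A -> infinite_set A.
Proof. by move=> fq qA /fq. Qed.

Lemma free_almost_sub q A B : free q -> q A -> A `<=* B -> q B.
Proof.
move=> fq qA /fq/ultra_notC qAB; apply: filterS (filterI qA qAB) => n [An nAB].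
by apply: contrapT => nBn; apply: nAB.
Qed.

Lemma free_split q A : free q -> q A ->
  exists B, [/\ B `<=` A, infinite_set B & ~ q B].
Proof.
move=> fq qA; have [B [BA iB iAB]] := infinite_split (free_infinite fq qA).
have [qB|nqB] := pselect (q B); last by exists B.
by exists (A `\` B); split=> [n []//|//|qAB];
  have /filter_ex[n [? []]] : q (B `&` (A `\` B)) by exact: filterI.
Qed.

(** Continuity on the subspace [P], tested on basic clopen sets. Maps are total on [beta_omega];
    only their values on [P] count. *)
Definition cont_on (P : set beta_omega) (h : beta_omega -> beta_omega) :=
  forall q, P q -> forall B, h q B ->
    exists2 A, q A & forall q', P q' -> q' A -> h q' B.

Definition homeo_sets (P Q : set beta_omega) := exists h k,
  [/\ [/\ forall q, P q -> Q (h q), forall q, P q -> k (h q) = q & cont_on P h] &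
      [/\ forall q, Q q -> P (k q), forall q, Q q -> h (k q) = q & cont_on Q k]].

(* The open subset of [omega_star] that Stone duality assigns to the ideal [J]. *)
Definition ideal_open (J : set (set nat)) : set beta_omega :=
  [set q | free q /\ exists2 A, J A & q A].

Section transport.
Variables (J J' : set (set nat)) (G : set nat -> set (nat * nat)).
Hypothesis GM : matching_system J J' G.

Definition pushforward (q : beta_omega) : set (set nat) :=
  [set B | exists i, q (rel_preimage (G i) B)].

Lemma ideal_open_dom q : ideal_open J q -> exists i, q (rel_dom (G i)).
Proof.
move=> [fq [A JA qA]]; have [i Ai] := matching_dom_cofinal GM JA.
by exists i; exact: free_almost_sub qA Ai.
Qed.

(** Passing to a common later stage loses finitely many pairs, which a free [q] does not see; there
    functionality makes the two images of a point agree. *)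
Lemma pushforwardI q A B : free q -> pushforward q A -> pushforward q B ->
  pushforward q (A `&` B).
Proof.
move=> fq [i qA] [j qB]; have [k ik jk] := matching_dir GM i j; exists k.
have qAk := free_almost_sub fq qA (rel_preimage_almost_sub A ik).
have qBk := free_almost_sub fq qB (rel_preimage_almost_sub B jk).
apply: filterS (filterI qAk qBk) => m [[n Gmn An] [n' Gmn' Bn']].
have [/= /(_ erefl) nn' _] := matching_inj GM Gmn Gmn'.
by exists n => //; split=> //; rewrite nn'.
Qed.

Lemma pushforwardS q A B : A `<=` B -> pushforward q A -> pushforward q B.
Proof.
by move=> AB [i qA]; exists i; apply: filterS qA => m [n Gmn An]; exists n; auto.
Qed.

(** Some domain [rel_dom (G i)] belongs to [q]; splitting it by whether the image lies in [A]
    decides [A]. *)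
Lemma pushforward_ultra q : ideal_open J q -> UltraFilter (pushforward q).
Proof.
move=> tq; have fq := tq.1; have [i qi] := ideal_open_dom tq.
apply: ultra_of_dichotomy.
  split; first by move=> [j /filter_ex[m [n]]].
  split; first by exists i.
    by move=> A B; exact: pushforwardI.
  by move=> A B; exact: pushforwardS.
move=> A; suff [?|?] : q (rel_preimage (G i) A) \/ q (rel_preimage (G i) (~` A)).
- by left; exists i.
- by right; exists i.
apply: ultra_setU; apply: filterS qi => m [n Gmn _].
by have [An|nAn] := pselect (A n); [left|right]; exists n.
Qed.

(** The value [q] is a default, excluded on [ideal_open J] by [pushforward_ultra]. *)
Definition transport q := if pselect (UltraFilter (pushforward q)) is left qU
  then BetaOmega qU else q.

Lemma transportE q B : ideal_open J q -> transport q B <-> pushforward q B.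
Proof. by move=> /pushforward_ultra qU; rewrite /transport; case: pselect. Qed.

Lemma transport_ideal_open q : ideal_open J q -> ideal_open J' (transport q).
Proof.
move=> tq; have fq := tq.1; split.
  (* Freeness is kept because injectivity of [G i] makes preimages of finite sets finite. *)
  move=> B fB /(transportE _ tq)[i]; apply: fq.
  apply: (@sub_finite_set _ _ (\bigcup_(n in B) [set m | G i (m, n)])).
    by move=> m [n Gmn Bn]; exists n.
  apply: bigcup_finite => // n _; apply: finite_subset1 => m m' Gmn Gm'n.
  by have [/= _] := matching_inj GM Gmn Gm'n; apply.
have [i qi] := ideal_open_dom tq; exists (rel_dom (converse (G i))).
  exact: matching_ran GM i.
apply/transportE => //; exists i; apply: filterS qi => m [n Gmn _].
by exists n => //; exists m.
Qed.

Lemma transport_cont : cont_on (ideal_open J) transport.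
Proof.
move=> q tq B /(transportE _ tq)[i qi]; exists (rel_preimage (G i) B) => //.
by move=> q' tq' q'i; apply/transportE => //; exists i.
Qed.

End transport.

(** By maximality it suffices that each [A] in [q] survives: [G i] followed by its converse returns
    every point of [A] in the domain to itself. *)
Lemma transportK J J' G q : matching_system J J' G -> ideal_open J q ->
  transport (fun i => converse (G i)) (transport G q) = q.
Proof.
move=> GM tq; have tq' := transport_ideal_open GM tq.
have GM' := converse_matching_system GM.
apply/esym/ultra_sub_eq => A qA; apply/(transportE GM' _ tq').
have [i qi] := ideal_open_dom GM tq; exists i; apply/(transportE GM _ tq); exists i.
by apply: filterS (filterI qA qi) => m [Am [n Gmn _]]; exists n => //; exists m.
Qed.

Lemma CH_ideal_open_homeo (J J' : set (set nat)) : continuum_hypothesis ->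
  P_ideal J -> nonprincipal J -> P_ideal J' -> nonprincipal J' ->
  homeo_sets (ideal_open J) (ideal_open J').
Proof.
move=> CH PJ nJ PJ' nJ'; have [G GM] := CH_matching_system CH PJ nJ PJ' nJ'.
have GM' := converse_matching_system GM.
exists (transport G), (transport (fun i => converse (G i))); split; split.
- exact: transport_ideal_open GM.
- by move=> q; exact: transportK GM.
- exact: transport_cont GM.
- exact: transport_ideal_open GM'.
- have GE : (fun i => converse (converse (G i))) = G.
    by apply/funext => i; rewrite converseK.
  by move=> q tq; rewrite -{1}GE; exact: transportK GM' tq.
- exact: transport_cont GM'.
Qed.

Definition open_in (P U : set beta_omega) :=
  forall q, U q -> exists2 A, q A & forall q', P q' -> q' A -> U q'.

(** The given homeomorphism is glued to the identity on the common complement; the pieces are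
    relatively clopen. *)
Lemma homeo_sets_patch (P P' U U' : set beta_omega) :
  U `<=` P -> U' `<=` P' -> P `\` U = P' `\` U' ->
  open_in P U -> open_in P (P `\` U) -> open_in P' U' -> open_in P' (P' `\` U') ->
  homeo_sets U U' -> homeo_sets P P'.
Proof.
move=> UP UP' PU oU oC oU' oC' [h [k [[hU hK hc] [kU kK kc]]]].
pose patch (V : set beta_omega) (f : beta_omega -> beta_omega) q :=
  if pselect (V q) then f q else q.
have patch1 V f q : V q -> patch V f q = f q by rewrite /patch; case: pselect.
have patch0 V f q : ~ V q -> patch V f q = q by rewrite /patch; case: pselect.
(* One direction in general form, applied to [h] and then to [k]. *)
have half (Q Q' V V' : set beta_omega) f g : V' `<=` Q' -> Q `\` V = Q' `\` V' ->
    open_in Q V -> open_in Q (Q `\` V) ->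
    (forall q, V q -> V' (f q)) -> (forall q, V q -> g (f q) = q) -> cont_on V f ->
    [/\ forall q, Q q -> Q' (patch V f q),
        forall q, Q q -> patch V' g (patch V f q) = q & cont_on Q (patch V f)].
  move=> VQ' QV oV oCV fV fK fc.
  have CV q : Q q -> ~ V q -> Q' q /\ ~ V' q.
    by move=> Qq nVq; rewrite -[_ /\ _]/((Q' `\` V') q) -QV.
  split=> [q Qq|q Qq|q Qq B].
  - have [Vq|nVq] := pselect (V q); first by rewrite patch1//; apply/VQ'/fV.
    by rewrite patch0//; have [] := CV _ Qq nVq.
  - have [Vq|nVq] := pselect (V q); first by rewrite !patch1 ?fK//; apply: fV.
    by rewrite !patch0//; have [] := CV _ Qq nVq.
  have [Vq|nVq] := pselect (V q).
    rewrite patch1// => /(fc _ Vq)[A qA AB]; have [C qC CV'] := oV _ Vq.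
    exists (A `&` C); first exact: filterI.
    move=> q' Qq' q'AC; have q'A : q' A by apply: filterS q'AC => ? [].
    have q'C : q' C by apply: filterS q'AC => ? [].
    by rewrite patch1; [apply: AB => //; apply: CV'|apply: CV'].
  rewrite patch0// => qB; have [C qC CV'] := oCV q (conj Qq nVq).
  exists (B `&` C); first exact: filterI.
  move=> q' Qq' q'BC; have q'C : q' C by apply: filterS q'BC => ? [].
  by rewrite patch0; [apply: filterS q'BC => ? []|have [] := CV' _ Qq' q'C].
exists (patch U h), (patch U' k); split; exact: half.
Qed.

(** * Splittings and P-points *)

(** For free [q] this is a P-ideal exactly when [q] is a P-point of [omega_star]; see [P_point_dual]
    and [dual_P_point]. *)
Definition dual_ideal (q : beta_omega) : set (set nat) := [set A | ~ q A].

Lemma dual_idealS q a b : free q -> dual_ideal q b -> a `<=* b -> dual_ideal q a.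
Proof. by move=> fq qb ab qa; apply: qb; exact: free_almost_sub qa ab. Qed.

Lemma dual_nonprincipal q : free q -> nonprincipal (dual_ideal q).
Proof.
move=> fq c /ultra_notC/(free_split fq)[B [Bc iB nqB]]; exists B => //.
by apply: sub_infinite_set iB => n Bn; split=> //; exact: Bc.
Qed.

Lemma ultra_neq (p q : beta_omega) : p <> q -> exists2 A, q A & ~ p A.
Proof.
move=> pq; apply: contrapT => nA; apply/pq/esym/ultra_sub_eq => A qA.
by apply: contrapT => npA; apply: nA; exists A.
Qed.

(** Choose [x k] at least [k] and outside [b 0], ..., [b k]: the range is unbounded, and [x k] lies
    in [b m] only if [k < m]. *)
Lemma pseudo_intersection (b : nat -> set nat) :
  (forall k, infinite_set (~` \bigcup_(m in `I_k) b m)) ->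
  exists2 s, infinite_set s & forall m, finite_set (s `&` b m).
Proof.
move=> bi.
have /choice[x xP] k : exists n, (k <= n)%N /\ ~ (\bigcup_(m in `I_k.+1) b m) n.
  have [n [bn nk]] := infinite_setN0 (infinite_setD (bi k.+1) (finite_II k)).
  by exists n; split=> //; rewrite leqNgt; apply/negP.
exists (range x).
  move=> /finite_seqP[s sE].
  pose N := (\max_(i <- s) i).+1.
  have : range x (x N) by [].
  rewrite sE /= => xs; have := @leq_bigmax_seq nat s xpredT id _ xs isT.
  by rewrite leqNgt => /negP; apply; have [] := xP N.
move=> m; apply: sub_finite_set (finite_image x (finite_II m)).
move=> _ [[k _ <-] bxk]; exists k => //=; rewrite ltnNge; apply/negP => mk.
by have [_] := xP k; apply; exists m.
Qed.

(** Removing [b m] for [m < n] from [a n] costs finitely many points, and then [b m] meets only the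
    pieces with [n <= m]. *)
Lemma countable_gap (a b : nat -> set nat) :
  (forall m n, finite_set (a n `&` b m)) ->
  exists2 s, forall n, a n `<=* s & forall m, finite_set (s `&` b m).
Proof.
move=> ab; exists (\bigcup_n (a n `\` \bigcup_(m in `I_n) b m)).
  move=> n; apply: (@sub_finite_set _ _ (\bigcup_(m in `I_n) (a n `&` b m))).
    move=> k [ank nk]; apply: contrapT => nb; apply: nk; exists n => //.
    by split=> // -[m mn bmk]; apply: nb; exists m.
  by apply: bigcup_finite => //; exact: finite_II.
move=> m; apply: (@sub_finite_set _ _ (\bigcup_(n in `I_m.+1) (a n `&` b m))).
  move=> k [[n _ [ank nb]] bmk]; exists n => //=; rewrite ltnS leqNgt.
  by apply/negP => mn; apply: nb; exists m.
by apply: bigcup_finite => //; exact: finite_II.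
Qed.

Lemma ultra_bigcup (q : beta_omega) (b : nat -> set nat) k :
  (forall m, ~ q (b m)) -> ~ q (\bigcup_(m in `I_k) b m).
Proof.
move=> nb; elim: k => [|k IH]; first by rewrite II0 bigcup_set0 => /filter_ex[].
rewrite IIS bigcup_setU bigcup_set1 => /ultra_setU[]; [exact: IH|exact: nb].
Qed.

(** The last clause makes [ideal_open J] relatively closed in [omega_star] minus [z]: free
    ultrafilters containing [A] but not [B] have a neighbourhood missing it. *)
Lemma CH_splitting z : continuum_hypothesis -> free z ->
  exists J, [/\ P_ideal J, nonprincipal J, J `<=` dual_ideal z &
    forall A, ~ z A -> exists2 B, J B & forall j, J j -> finite_set ((A `\` B) `&` j)].
Proof.
move=> CH fz.
(* If [z] is a P-point, the dual ideal serves and the second part of the splitting is empty. *)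
have [Pz|nPz] := pselect (P_ideal (dual_ideal z)).
  exists (dual_ideal z); split=> //; first exact: dual_nonprincipal.
  by move=> A zA; exists A => // j _; rewrite setDv set0I.
(* [E] is a sequence without a bound in the dual ideal: if [a] in [z] were almost disjoint from
   every [E n], its complement would be a bound. *)
have [E [zE zP]] : exists E : nat -> set nat, (forall n, ~ z (E n)) /\
    forall a, (forall n, finite_set (a `&` E n)) -> ~ z a.
  apply: contrapT => /forallNP nE; apply: nPz; split.
  - by move=> /filter_ex[].
  - by move=> a b; exact: dual_idealS.
  move=> a za; have := nE a; move/not_andP => [|/existsNP[b]]; first by [].
  move=> /not_implyP[ab /contrapT zb]; exists (~` b).
    by move=> /ultra_notC; apply.
  by move=> n; rewrite /almost_sub setDE setCK setIC.
(* A condition [(j, B)] promises that [J] stays almost disjoint from the members of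
   the countable set [B]; as [B] contains all [E n], this keeps [j] out of [z]. *)
pose V := [set t : set nat * set (set nat) | [/\ countable t.2,
  forall n, t.2 (E n) & forall B, t.2 B -> ~ z B /\ finite_set (t.1 `&` B)]].
pose R (t t' : set nat * set (set nat)) := t.1 `<=* t'.1 /\ t.2 `<=` t'.2.
(* For [A] outside [z], the promise on [A] minus [t.1] gives the splitting clause, and the infinite
   difference gives nonprincipality. *)
pose D A := [set t : set nat * set (set nat) |
  ~ z A -> t.2 (A `\` t.1) /\ infinite_set (t.1 `\` A)].
have Vz t : V t -> ~ z t.1.
  by move=> [_ tE tB]; apply: zP => n; have [] := tB _ (tE n).
have enum (B : set (set nat)) : countable B -> (forall n, B (E n)) ->
    exists b : nat -> set nat, range b = B.
  by move=> cB BE; apply: countable_enum => //; exists (E 0).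
have [|||||x [xV xD xdir]] := @CH_generic_family _ V R D CH.
- by move=> t _; split=> //; exact: almost_sub_refl.
- move=> t u v [tu1 tu2] [uv1 uv2].
  by split; [exact: almost_sub_trans uv1|exact: subset_trans uv2].
- exists (set0, range E); split=> /=.
  + exact: card_image_le.
  + by move=> n; exists n.
  + by move=> _ [n _ <-]; split=> //; rewrite set0I.
- move=> x xV xR.
  pose B := \bigcup_n (x n).2.
  have cB : countable B by apply: bigcup_countable => // n _; have [] := xV n.
  have BE n : B (E n) by exists 0 => //; have [] := xV 0.
  have [b bB] := enum B cB BE.
  (* The promise [b m] was made at some stage [k]: either [(x n).1] is almost included in [(x k).1],
     or stage [n] has inherited the promise. *)
  have bx m n : finite_set ((x n).1 `&` b m).
    have : B (b m) by rewrite -bB; exists m.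
    move=> [k _ xkb]; have [_ _ xkB] := xV k; have [_ xkf] := xkB _ xkb.
    have [[nk _]|[_ kn]] := xR n k; first exact: almost_subI_finite nk xkf.
    by have [_ _ xnB] := xV n; have [] := xnB _ (kn _ xkb).
  have [s xs sb] := countable_gap bx.
  exists (s, B).
    split=> //= C BC; split; last by move: BC; rewrite -bB => -[m _ <-].
    by move: BC => [n _ xnC]; have [_ _ /(_ _ xnC)[]] := xV n.
  by move=> n; split=> //= C xnC; exists n.
- move=> A [j B] Vt; have [/= cB BE jB] := Vt.
  have [zA|nzA] := pselect (z A).
    by exists (j, B) => //; do!split=> //; exact: almost_sub_refl.
  have [b bB] := enum B cB BE.
  (* Prepending [A] to the promises yields an infinite [s] almost disjoint from [A] and from all of
     them; adding [s] to [j] breaks no promise. *)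
  pose c m := if m is m'.+1 then b m' else A.
  have zc m : ~ z (c m).
    case: m => [|m] //=; have : B (b m) by rewrite -bB; exists m.
    by move=> /jB[].
  have [k|s is_ sc] := @pseudo_intersection c.
    by apply: (free_infinite fz); apply/ultra_notC/ultra_bigcup.
  have zj : ~ z j := Vz _ Vt.
  have sB C : B C -> finite_set (s `&` C).
    by rewrite -bB => -[m _ <-]; exact: (sc m.+1).
  exists (j `|` s, (A `\` (j `|` s)) |` B).
    split=> /=.
    + rewrite -bigcup2E; apply: bigcup_countable => // -[|[|k]] _ //=.
    + by move=> n; right.
    + move=> C [->|BC].
        split; first by move=> zAj; apply: nzA; apply: filterS zAj => ? [].
        by apply: (@sub_finite_set _ _ set0) => // n [? []].
      have [zC jC] := jB _ BC; split=> //.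
      by rewrite setIUl finite_setU; split=> //; exact: sB.
  split; first by split=> /=; [exact/subset_almost_sub/subsetUl|exact: subsetUr].
  move=> _ /=; split; first by left.
  apply: (@sub_infinite_set _ (s `\` (s `&` A))); last first.
    exact: infinite_setD (sc 0).
  by move=> n [sn nA]; split=> [|An]; [right|apply: nA].
pose J := [set a | exists A, a `<=* (x A).1].
have Jz : J `<=` dual_ideal z.
  by move=> a [A aA]; apply: dual_idealS fz _ aA; exact: Vz.
exists J; split=> //.
- split.
  + by exists set0; apply: subset_almost_sub => ?.
  + by move=> a b [A bA] ab; exists A; exact: almost_sub_trans bA.
  + move=> a /choice[s sP]; have [A AP] := xdir s; exists (x A).1.
      by exists A; exact: almost_sub_refl.
    by move=> n; have [+ _] := AP n; exact: almost_sub_trans.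
- move=> c /Jz zc; exists (x c).1; first by exists c; exact: almost_sub_refl.
  by have [] := xD c zc.
move=> A zA; exists (x A).1; first by exists A; exact: almost_sub_refl.
(* A stage above both [A] and [C] still keeps the promise made at stage [A]. *)
move=> j [C jC]; have [k kP] := xdir (fun n => if n is 0 then A else C).
have [_ Ak] := kP 0; have [Ck _] := kP 1.
have [xA _] := xD A zA.
have [_ _ /(_ _ (Ak _ xA))[_ fk]] := xV k.
by rewrite setIC; apply: almost_subI_finite fk; exact: almost_sub_trans Ck.
Qed.

(** With [A] in [p] but not in [z], the remainder [k] of [A] is almost disjoint from [J] and outside
    [z]. Absorbing [k] into the ideal brings in [p] and keeps the splitting. *)
Lemma CH_splitting_at z p : continuum_hypothesis -> free z -> free p -> p <> z ->
  exists J, [/\ [/\ P_ideal J, nonprincipal J & J `<=` dual_ideal z],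
    (exists2 A, J A & p A) &
    forall A, ~ z A -> exists2 B, J B & forall j, J j -> finite_set ((A `\` B) `&` j)].
Proof.
move=> CH fz fp pz; have [J [PJ nJ Jz JK]] := CH_splitting CH fz.
have [A pA zA] := ultra_neq (nesym pz).
have [B JB AB] := JK A zA.
pose k := A `\` B; have zk : ~ z k by move=> zk; apply: zA; apply: filterS zk => ? [].
exists [set a | J (a `\` k)]; split; first split.
- split.
  + by rewrite /= set0D; exact: P_ideal0 PJ.
  + move=> a b /= Jb ab; apply: (P_idealS PJ Jb).
    by apply: sub_finite_set ab => n [[an nk] nb]; split=> // bn; apply: nb.
  + move=> a /= Ja; have [b Jb ab] := P_ideal_bound PJ Ja.
    exists (b `|` k).
      by apply: (P_idealS PJ Jb); apply: subset_almost_sub => n [[]].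
    move=> n; apply: sub_finite_set (ab n) => m [anm nbk].
    by split=> [|bm]; [split=> // km|]; apply: nbk; [right|left].
- move=> c /= Jc; have [a Ja iac] := nJ _ Jc; exists a.
    by apply: (P_idealS PJ Ja); apply: subset_almost_sub => n [].
  apply: (@sub_infinite_set _ ((a `\` (c `\` k)) `\` (k `&` a))).
    by move=> n [[an nck] nka]; split=> // cn; apply: nck; split=> // kn; apply: nka.
  by apply: infinite_setD => //; exact: AB.
- move=> a /= Ja za; have /ultra_setU[/(Jz _ Ja)//|//] : z ((a `\` k) `|` k).
  by apply: filterS za => n an; have [kn|kn] := pselect (k n); [right|left].
- exists (B `|` k).
    by apply: (P_idealS PJ JB); apply: subset_almost_sub => n [[]].
  by apply: filterS pA => n An; have [Bn|nBn] := pselect (B n); [left|right].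
move=> C /JK[B' JB' CB']; exists (B' `|` k).
  by apply: (P_idealS PJ JB'); apply: subset_almost_sub => n [[]].
move=> j /CB'; apply: sub_finite_set => n [[Cn nBk] jn].
by split; split=> // ?; apply: nBk; [left|right].
Qed.

(** Bounds in the two ideals intersect to a common bound. For [c] outside [p], the set [A] minus [c]
    is in [p] and has an infinite subset outside [p]. *)
Lemma P_ideal_remove J p : P_ideal J -> nonprincipal J -> free p ->
  P_ideal (dual_ideal p) -> (exists2 A, J A & p A) ->
  P_ideal (J `&` dual_ideal p) /\ nonprincipal (J `&` dual_ideal p).
Proof.
move=> PJ nJ fp Pp [A JA pA]; split.
  split.
  - by split; [exact: P_ideal0 PJ|exact: P_ideal0 Pp].
  - move=> a b [Jb pb] ab.
    by split; [exact: (P_idealS PJ Jb ab)|exact: (P_idealS Pp pb ab)].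
  move=> a Ja; have [b Jb ab] := P_ideal_bound PJ (fun n => (Ja n).1).
  have [c pc ac] := P_ideal_bound Pp (fun n => (Ja n).2).
  exists (b `&` c).
    split; first by apply: (P_idealS PJ Jb); apply: subset_almost_sub => n [].
    by apply: (P_idealS Pp pc); apply: subset_almost_sub => n [].
  by move=> n; rewrite /almost_sub setDIr finite_setU; split; [exact: ab|exact: ac].
move=> c [Jc pc]; have pAc : p (A `\` c) by apply: filterI => //; exact/ultra_notC.
have [B [BA iB npB]] := free_split fp pAc; exists B.
  split=> //; apply: (P_idealS PJ JA); apply: subset_almost_sub => n /BA[] //.
by apply: sub_infinite_set iB => n Bn; split=> //; have [] := BA _ Bn.
Qed.

Lemma CH_P_point_removal p z : continuum_hypothesis -> free p -> free z ->
  p <> z -> P_ideal (dual_ideal p) ->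
  homeo_sets [set q | free q /\ q <> z] ([set q | free q /\ q <> z] `\ p).
Proof.
move=> CH fp fz pz Pp.
have [J [[PJ nJ Jz] Jp JK]] := CH_splitting_at CH fz fp pz.
have [PJ' nJ'] := P_ideal_remove PJ nJ fp Pp Jp.
set P := [set q | _]; set J' := J `&` _ in PJ' nJ'.
have UP : ideal_open J `<=` P.
  by move=> q [fq [A JA qA]]; split=> // qz; apply: (Jz _ JA); rewrite -qz.
have U'U : ideal_open J' `<=` ideal_open J.
  by move=> q [fq [A [JA _] qA]]; split=> //; exists A.
have U'P : ideal_open J' `<=` P `\ p.
  move=> q U'q; split; first exact/UP/U'U.
  by move: U'q => [_ [A [_ pA] qA]] /= qp; apply: pA; rewrite -qp.
(* The complements agree because [ideal_open J'] is [ideal_open J] without [p]: any other [q]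
   contains a set outside [p], with which [A] can be cut down. *)
have PU : P `\` ideal_open J = (P `\ p) `\` ideal_open J'.
  apply/seteqP; split=> q.
    by move=> [Pq nU]; split; [split=> // qp; apply: nU; rewrite qp|move=> /U'U].
  move=> [[Pq qp] nU']; split=> // -[fq [A JA qA]]; apply: nU'; split=> //.
  have [C qC pC] := ultra_neq (nesym qp); exists (A `&` C); last exact: filterI.
  split; first by apply: (P_idealS PJ JA); apply: subset_almost_sub => n [].
  by move=> pAC; apply: pC; apply: filterS pAC => n [].
(* The splitting clause supplies the neighbourhood: a free ultrafilter containing [A] minus [B]
   cannot meet [J]. *)
have oC : open_in P (P `\` ideal_open J).
  move=> q [Pq nU]; have [A qA zA] := ultra_neq (nesym Pq.2).
  have [B JB AB] := JK A zA; have fq := Pq.1.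
  have nqB : ~ q B by move=> qB; apply: nU; split=> //; exists B.
  exists (A `\` B); first by apply: filterI => //; exact/ultra_notC.
  move=> q' Pq' q'AB; split=> // -[fq' [j Jj q'j]].
  exact: fq' (AB _ Jj) (filterI q'AB q'j).
have oU K Q : Q `<=` P -> open_in Q (ideal_open K).
  move=> QP q [fq [A KA qA]]; exists A => // q' /QP Pq' q'A.
  by split; [case: Pq'|exists A].
apply: (@homeo_sets_patch _ _ (ideal_open J) (ideal_open J')) => //.
- exact: oU.
- by apply: oU => q [].
- rewrite -PU => q Uq; have [A qA AP] := oC q Uq; exists A => // q' [Pq' _].
  exact: AP.
- exact: CH_ideal_open_homeo.
Qed.

(** * Existence of P-points and of free ultrafilters *)

(** An almost-decreasing tower of infinite subsets of [A] that decides every set generates the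
    ultrafilter; countable sets of stages have a later one, which makes it a P-point. *)
Lemma CH_P_point_exists A : continuum_hypothesis -> infinite_set A ->
  exists q, [/\ free q, q A & P_ideal (dual_ideal q)].
Proof.
move=> CH iA.
pose V := [set s : set nat | infinite_set s /\ s `<=` A].
pose D C := [set s : set nat | s `<=* C \/ s `<=* ~` C].
have [|||||x [xV xD xdir]] := @CH_generic_family _ V (fun s t => t `<=* s) D CH.
- by move=> s _; exact: almost_sub_refl.
- by move=> s t u ts ut; exact: almost_sub_trans ts.
- by exists A; split.
- move=> x xV xR.
  (* Finitely many comparable terms have an almost-least one, so their intersection is infinite. *)
  have min k : exists n, forall m, (m < k)%N -> x n `<=* x m.
    elim: k => [|k [n nP]]; first by exists 0.
    have [kn|nk] := xR k n.
      by exists n => m; rewrite ltnS leq_eqVlt => /orP[/eqP->|/nP].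
    exists k => m; rewrite ltnS leq_eqVlt => /orP[/eqP->|/nP nm].
      exact: almost_sub_refl.
    exact: almost_sub_trans nm.
  have [k|s is_ sx] := @pseudo_intersection (fun m => ~` x m).
    have [n nP] := min k; have [ixn _] := xV n.
    apply: (@sub_infinite_set _ (x n `\` \bigcup_(m in `I_k) (x n `\` x m))).
      by move=> i [xni ni] [m mk xmi]; apply: ni; exists m.
    by apply: infinite_setD => //; apply: bigcup_finite => //; exact: finite_II.
  have sxm m : s `<=* x m by have := sx m; rewrite -setDE.
  have sA : s `<=* A by apply: almost_sub_trans (sxm 0) (subset_almost_sub (xV 0).2).
  exists (s `&` A).
    split; last exact: subIsetr.
    by have := infinite_setD is_ sA; rewrite setDD.
  by move=> n; apply: sub_almost_sub (sxm n) => i [].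
- move=> C s [is_ sA].
  have [fC|iC] := pselect (finite_set (s `&` C)).
    exists s => //; split; first exact: almost_sub_refl.
    by right; rewrite /almost_sub setDE setCK.
  exists (s `&` C); first by split=> // n [/sA].
  by split; [|left]; apply: subset_almost_sub => n [].
pose F := [set C | exists B, x B `<=* C].
have FU : UltraFilter F.
  apply: ultra_of_dichotomy.
    split.
      by move=> [B]; rewrite /almost_sub setD0; have [] := xV B.
    split.
    - by exists set0; exact: subset_almost_sub.
    - move=> C C' [B BC] [B' BC'].
      have [k kP] := xdir (fun n => if n is 0 then B else B'); exists k.
      rewrite /almost_sub setDIr finite_setU; split.
        exact: almost_sub_trans (kP 0) BC.
      exact: almost_sub_trans (kP 1) BC'.
    - move=> C C' CC' [B BC]; exists B.
      exact: almost_sub_trans BC (subset_almost_sub CC').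
  by move=> C; have [?|?] := xD C; [left|right]; exists C.
exists (BetaOmega FU); split.
- move=> C fC [B BC]; have [iB _] := xV B; apply: iB.
  apply: (@sub_finite_set _ _ ((x B `\` C) `|` C)); last by rewrite finite_setU.
  by move=> n xn; have [Cn|nCn] := pselect (C n); [right|left].
- by exists set0; exact: subset_almost_sub (xV _).2.
- split.
  + by move=> /= [B]; rewrite /almost_sub setD0; have [] := xV B.
  + by move=> a b nb ab [B Ba]; apply: nb; exists B; exact: almost_sub_trans ab.
  (* [x B] lies almost below every [x (a n)], which is almost disjoint from [a n]; hence its
     complement is a bound. *)
  move=> a na; have [B BP] := xdir a; exists (~` x B).
    move=> [C CB].
    have [k kP] := xdir (fun n => if n is 0 then B else C).
    have [ik _] := xV k; apply: ik.
    have := almost_sub_trans (kP 1) CB; have := kP 0.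
    rewrite /almost_sub => f1 f2.
    apply: (@sub_finite_set _ _ ((x k `\` x B) `|` (x k `\` ~` x B))).
      by move=> n xn; have [Bn|nBn] := pselect (x B n); [right; split|left].
    by rewrite finite_setU.
  move=> n; have [xa|xa] := xD (a n); first by case: (na n); exists (a n).
  have := almost_sub_trans (BP n) xa.
  by rewrite /almost_sub !setDE !setCK setIC.
Qed.

Lemma free_ultra_exists A : infinite_set A -> exists q, free q /\ q A.
Proof.
move=> iA; have [|F [FU AF]] := @ultraFilterLemma _ [set C | A `<=* C].
  split; first by rewrite /almost_sub /= setD0.
  split=> [|C C' AC AC'|C C' CC' AC].
  - exact: subset_almost_sub.
  - by rewrite /= /almost_sub setDIr finite_setU; split.
  - exact: almost_sub_trans AC (subset_almost_sub CC').
exists (BetaOmega FU); split; last exact/AF/almost_sub_refl.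
move=> C fC FC; have FnC : F (~` C).
  by apply: AF; rewrite /= /almost_sub setDE setCK; apply: sub_finite_set fC => n [].
by have /filter_ex[n []] : F (C `&` ~` C) by exact: filterI.
Qed.

(** * Cards of omega-star *)

(** [i] is a homeomorphism onto the subspace [P]; nested subtypes thereby become plain sets of
    ultrafilters. *)
Definition represents (X : topologicalType) (i : X -> beta_omega)
    (P : set beta_omega) := [/\ injective i, range i = P &
  forall x U, nbhs x U <-> exists2 A, i x A & forall y, i y A -> U y].

Lemma represents_subtype (X : topologicalType) (i : X -> beta_omega) P (A : set X) :
  represents i P -> represents (X := set_type A) (fun x => i (set_val x)) (i @` A).
Proof.
move=> [iinj _ inbhs]; split.
- by move=> x y /iinj; rewrite set_valE => /val_inj.
- apply/seteqP; split=> [_ [x _ <-]|_ [x Ax <-]].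
    by exists (set_val x) => //; exact: set_valP.
  by exists (SigSub (mem_set Ax)).
move=> x U; split.
  rewrite nbhsE => -[V [[W oW <-] Wx] WU].
  have /inbhs[B xB BW] : nbhs (set_val x) W by apply: open_nbhs_nbhs; split.
  by exists B => // y yB; apply: WU; exact: BW.
move=> [B xB BU].
have xBn : nbhs (set_val x) [set y | i y B] by apply/inbhs; exists B.
have : nbhs x (set_val @^-1` [set y | i y B]) by exact: initial_continuous xBn.
by apply: filterS => y; exact: BU.
Qed.

Lemma beta_represents : represents (X := beta_omega) id setT.
Proof.
split=> // [|q U].
  by apply/seteqP; split=> // q _; exists q.
split=> [|[A qA AU]].
  by rewrite nbhsE => -[V [oV Vq] VU]; have [A qA AV] := open_beta_basicP oV Vq;
    exists A => // r rA; apply/VU/AV.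
rewrite nbhsE; exists (beta_basic A) => //.
by split=> //; exact: open_beta_basic.
Qed.

Lemma freeP q : free q <-> ~ range principal q.
Proof.
split=> [fq [n _ nq]|nq A /finite_seqP[s ->]].
  by apply: (fq [set n]) => //; rewrite -nq; exact/principal_filterP.
elim: s => [|n s IH]; first by rewrite set_nil => /filter_ex[].
move=> qns; have /ultra_setU[qn|//] : q ([set n] `|` [set` s]).
  by apply: filterS qns => m; rewrite /= inE => /orP[/eqP ->|ms]; [left|right].
apply: nq; exists n => //.
apply: ultra_sub_eq => B /principal_filterP Bn.
by apply: filterS qn => _ ->.
Qed.

Definition star_val (p : omega_star) : beta_omega := set_val p.

Lemma omega_star_represents :
  represents star_val [set q | free q].
Proof.
have -> : [set q | free q] = id @` (~` range principal).
  by rewrite image_id; apply/seteqP; split=> q /freeP.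
exact: represents_subtype beta_represents.
Qed.

Lemma remove_point_represents (X : topologicalType) (i : X -> beta_omega) P x :
  represents i P ->
  represents (X := remove_point x) (fun y => i (set_val y)) (P `\ i x).
Proof.
move=> iP; have [iinj <- _] := iP.
have -> : range i `\ i x = i @` (~` [set x]).
  apply/seteqP; split=> [_ [[y _ <-] yx]|_ [y yx <-]].
    by exists y => // yE; apply: yx; rewrite yE.
  by split=> [|/iinj]; [exists y|].
exact: represents_subtype iP.
Qed.

Lemma represents_homeomorphic (X Y : topologicalType) (i : X -> beta_omega)
    (j : Y -> beta_omega) P Q :
  represents i P -> represents j Q -> homeo_sets P Q -> homeomorphic X Y.
Proof.
move=> [iinj iP inb] [jinj jQ jnb] [h [k [[hP hK hc] [kQ kK kc]]]].
have Pi x : P (i x) by rewrite -iP; exists x.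
have Qj y : Q (j y) by rewrite -jQ; exists y.
have /choice[f fE] x : exists y, j y = h (i x).
  by have := hP _ (Pi x); rewrite -jQ => -[y _ <-]; exists y.
have /choice[g gE] y : exists x, i x = k (j y).
  by have := kQ _ (Qj y); rewrite -iP => -[x _ <-]; exists x.
exists f, g; split.
- move=> x U /jnb[B]; rewrite fE => /(hc _ (Pi x))[A xA AB] BU.
  by apply/inb; exists A => // x' x'A; apply: BU; rewrite fE; exact: AB.
- move=> y U /inb[B]; rewrite gE => /(kc _ (Qj y))[A yA AB] BU.
  by apply/jnb; exists A => // y' y'A; apply: BU; rewrite gE; exact: AB.
- by move=> x; apply: iinj; rewrite gE fE hK.
- by move=> y; apply: jinj; rewrite fE gE kK.
Qed.

Lemma homeomorphic_sym (X Y : topologicalType) :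
  homeomorphic X Y -> homeomorphic Y X.
Proof. by move=> [f [g [fc gc fg gf]]]; exists g, f; split. Qed.

Lemma omega_star_free (p : omega_star) : free (star_val p).
Proof. by apply/freeP; exact: (set_valP p). Qed.

Lemma omega_star_surj q : free q -> exists p : omega_star, star_val p = q.
Proof.
move=> fq; have [_ rE _] := omega_star_represents.
by have : [set q | free q] q by []; rewrite -rE => -[p _ <-]; exists p.
Qed.

(** Let [B] in [p] give a basic neighbourhood inside all sets of [q] avoiding [a n]. An infinite
    intersection of [a n] with [B] would lie in a free ultrafilter, so the complement of [B] is a
    bound. *)
Lemma P_point_dual (p : omega_star) : P_point p -> P_ideal (dual_ideal (star_val p)).
Proof.
move=> Pp; have fp := @omega_star_free p; have [_ _ nb] := omega_star_represents.
split; [by move=> /filter_ex[]|by move=> a b; exact: dual_idealS fp|move=> a pa].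
have [|V /nb[B pB BV] VU] := Pp (fun n => [set q : omega_star | ~ star_val q (a n)]).
  move=> n; apply/nb; exists (~` a n); first by apply/ultra_notC; exact: pa.
  by move=> q /ultra_notC.
exists (~` B); first by move=> /ultra_notC; apply.
move=> n; rewrite /almost_sub setDE setCK; apply: contrapT => inf.
have [q [fq qaB]] := free_ultra_exists inf; have [r rq] := omega_star_surj fq.
have : V r by apply: BV; rewrite rq; apply: filterS qaB => m [].
by move=> /VU/(_ n I) /=; rewrite rq; apply; apply: filterS qaB => m [].
Qed.

Lemma dual_P_point (p : omega_star) : P_ideal (dual_ideal (star_val p)) -> P_point p.
Proof.
move=> Pp U pU; have fp := @omega_star_free p; have [_ _ nb] := omega_star_represents.
have /choice[A AP] n : exists A, star_val p A /\
    forall q : omega_star, star_val q A -> U n q.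
  by have /nb[A pA AU] := pU n; exists A.
have [n|b pb Ab] := P_ideal_bound Pp (a := fun n => ~` A n).
  by move=> /ultra_notC; apply; have [] := AP n.
exists [set q : omega_star | star_val q (~` b)].
  by apply/nb; exists (~` b) => //; exact/ultra_notC.
move=> q qb n _; apply: (AP n).2; apply: free_almost_sub qb _ => //.
  exact: omega_star_free.
by have /= := Ab n; rewrite /almost_sub !setDE setIC.
Qed.

(** * Compactness of the remainder, and its failure for cards *)

(** A limit in [beta_omega] of free ultrafilters is free, since a finite set in it would belong to
    one of them. *)
Lemma omega_star_compact : compact [set: omega_star].
Proof.
have [_ rE nb] := omega_star_represents.
rewrite compact_ultra => F FU _.
have GU := @ultra_fmap _ _ star_val _ FU.
have := beta_omega_compact; rewrite compact_ultra => /(_ _ GU filterT)[r [_ rP]].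
have basic A : r A -> F [set q : omega_star | star_val q A].
  move=> rA; apply: (rP (beta_basic A)); apply: open_nbhs_nbhs; split=> //.
  exact: open_beta_basic.
have fr : free r.
  move=> A fA /basic /filter_ex[q]; exact: omega_star_free.
have [x xr] := omega_star_surj fr; exists x; split=> // U /nb[A].
by rewrite xr => /basic FA AU; apply: filterS FA => y; exact: AU.
Qed.

(** The trace [F] of the neighbourhoods of [p] is proper, as [p] is not isolated, and any other
    point is separated from [p] by a clopen set. *)
Lemma remove_point_not_compact (p : omega_star) :
  ~ compact [set: remove_point p].
Proof.
move=> cp; have fp := @omega_star_free p.
have [_ rE nb] := remove_point_represents p omega_star_represents.
pose F : set_system (remove_point p) := [set S | exists2 A, star_val p A &
  forall q : remove_point p, star_val (set_val q) A -> S q].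
have FF : ProperFilter F.
  split.
    move=> [A pA A0]; have [B [BA iB pB]] := free_split fp pA.
    have [q [fq qB]] := free_ultra_exists iB.
    have : ([set q | free q] `\ star_val p) q by split=> // qp; rewrite -qp in pB.
    rewrite -rE => -[r _ rq]; apply: (A0 r); rewrite rq.
    exact: filterS BA qB.
  split.
  - by exists setT => //; exact: filterT.
  - move=> S T [A pA AS] [B pB BT]; exists (A `&` B); first exact: filterI.
    by move=> q qAB; split; [apply: AS|apply: BT]; apply: filterS qAB => n [].
  - by move=> S T ST [A pA AS]; exists A => // q /AS/ST.
have [x [_ xF]] := cp F FF filterT.
have xp : star_val p <> star_val (set_val x) :> beta_omega.
  have : range (fun y : remove_point p => star_val (set_val y)) (star_val (set_val x)).
    by exists x.
  by rewrite rE => -[_ /nesym].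
have [A xA pA] := ultra_neq xp.
have [|| q [q1 q2]] := xF [set q : remove_point p | star_val (set_val q) (~` A)]
                          [set q : remove_point p | star_val (set_val q) A].
- by exists (~` A) => //; exact/ultra_notC.
- by apply/nb; exists A.
by move/ultra_notC: q1; apply.
Qed.

Lemma compact_homeomorphic (X Y : topologicalType) :
  homeomorphic X Y -> compact [set: X] -> compact [set: Y].
Proof.
move=> [f [g [fc _ _ gf]]] cX; have -> : [set: Y] = f @` setT.
  by apply/seteqP; split=> // y _; exists (g y).
by apply: continuous_compact => //; exact: continuous_subspaceT.
Qed.

Theorem theorem6p1 :
  continuum_hypothesis ->
  ~ reconstructible omega_star /\
  forall p : omega_star, P_point p ->
    reconstruction (remove_point p) omega_star /\
    ~ homeomorphic (remove_point p) omega_star.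
Proof.
move=> CH.
suff main (p : omega_star) : P_point p ->
    reconstruction (remove_point p) omega_star /\
    ~ homeomorphic (remove_point p) omega_star.
  split=> // rec.
  have [q [fq _ Pq]] := CH_P_point_exists CH infinite_nat.
  have [p pq] := omega_star_surj fq.
  have [|deck nh] := main p; first by apply: dual_P_point; rewrite pq.
  exact/nh/homeomorphic_sym/rec.
move=> Pp; have Pdp := P_point_dual Pp; have fp := @omega_star_free p.
have R := omega_star_represents; have Rp := remove_point_represents p R.
have vinj : injective star_val by case: R.
have cardE (z : remove_point p) :
    homeomorphic (remove_point (set_val z)) (remove_point z).
  have Rz := remove_point_represents (set_val z) R.
  have Rpz := remove_point_represents z Rp.
  (* The rewriting exchanges the order in which [p] and [z] are removed. *)
  apply: represents_homeomorphic Rz Rpz _; rewrite setDDl setUC -setDDl.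
  apply: CH_P_point_removal => //; first exact: omega_star_free.
  by move=> /vinj/esym; exact: (set_valP z).
split; last first.
  move=> h; apply: (@remove_point_not_compact p).
  exact: compact_homeomorphic (homeomorphic_sym h) omega_star_compact.
have lift (x : omega_star) : x <> p -> exists z : remove_point p, set_val z = x.
  by move=> xp; exists (SigSub (mem_set (xp : (~` [set p]) x))).
split=> [x|z]; last first.
  by exists (set_val z); exact/homeomorphic_sym/cardE.
have [->|/lift[z <-]] := pselect (x = p); last by exists z; exact: cardE.
(* The card at [p] needs a second P-point: one containing an infinite set outside [p] differs from
   [p]. *)
have [B [_ iB pB]] := free_split fp filterT.
have [q [fq qB Pq]] := CH_P_point_exists CH iB.
have [y yq] := omega_star_surj fq.
have [|z zy] := lift y; first by move=> yp; apply: pB; rewrite -yp yq.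
exists z; apply: represents_homeomorphic (remove_point_represents p R)
  (remove_point_represents z Rp) _.
rewrite zy; apply: CH_P_point_removal => //; rewrite ?yq //.
by move=> qp; rewrite -qp in pB.
Qed.
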